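(* Define $h:\mathbb{R}^2\to\mathbb{R}$ by $h(0)=0$ and $h(z)=\dfrac{z_1^3-3z_1z_2^2}{\sqrt{z_1^2+z_2^2}}$ for $z=(z_1,z_2)\neq 0$, let $g(z)=4\|z\|^2+h(z)$ for $z\in\mathbb{R}^2$, and let $$S=\{(z,t)\in\mathbb{R}^2\times\mathbb{R}: t\ge g(z)\}.$$ Then $S$ is closed, convex and semialgebraic. Moreover, $S$ is not $C^2$-cone reducible at $\bar x=(0,0,0)$.
   Context: A nonempty closed convex set $S\subset\mathbb{R}^n$ is $C^2$-cone reducible at $x_0\in S$ if there exist a pointed closed convex cone $C\subset\mathbb{R}^m$ ($m=0$ allowed, with $\mathbb{R}^0=\{0\}$), a neighborhood $U$ of $x_0$ and a $C^2$ function $\Xi:U\to\mathbb{R}^m$ such that $\Xi'(x_0):\mathbb{R}^n\to\mathbb{R}^m$ is onto, $\Xi(x_0)=0$, and $S\cap U=\{x\in U:\Xi(x)\in C\}$. *)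

(* Defs.v *)
From HB Require Import structures.
From mathcomp Require Import all_boot all_order all_algebra.
From mathcomp Require Import all_classical all_reals all_analysis.
(* Not imported: the notations of mpoly clash with those of analysis. *)
From mathcomp Require mpoly.
Set Implicit Arguments.
Unset Strict Implicit.
Unset Printing Implicit Defensive.
Import Order.TTheory GRing.Theory Num.Theory.
Import numFieldNormedType.Exports.
Local Open Scope classical_set_scope.
Local Open Scope ring_scope.

(* Finite union of sets cut out by finitely many polynomial equations p = 0
   (p in c.1) and strict inequalities q > 0 (q in c.2). *)
Definition semialgebraic (R : realType) (n : nat) (A : set 'rV[R]_n) : Prop :=
  exists s : seq (seq (mpoly.mpoly n R) * seq (mpoly.mpoly n R)),
    A = [set x : 'rV[R]_n |
          has (fun c => all (fun p => mpoly.meval (x ord0) p == 0) c.1 &&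
                        all (fun q => 0 < mpoly.meval (x ord0) q) c.2) s].

Definition pointed_closed_convex_cone (R : realType) (m : nat)
    (C : set 'rV[R]_m) : Prop :=
  [/\ C !=set0,
      forall (a : R) (x : 'rV[R]_m), 0 <= a -> C x -> C (a *: x),
      closed C,
      convex_set (C : set (convex_lmodType 'rV[R]_m)) &
      forall x : 'rV[R]_m, C x -> C (- x) -> x = 0].

(* f' is taken with values in matrices ('J f, acting on row vectors on the
   right).  As the spaces are finite-dimensional, continuity of the second
   derivative is the same as its continuity along each fixed direction v. *)
Definition C2_on (R : realType) (n m : nat) (U : set 'rV[R]_n)
    (f : 'rV[R]_n -> 'rV[R]_m) : Prop :=
  forall x : 'rV[R]_n, U x ->
    [/\ differentiable f x,
        differentiable (jacobian f) x &
        forall v : 'rV[R]_n,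
          {for x, continuous (fun y : 'rV[R]_n => 'd (jacobian f) y v)}].

(* x0 \in S is not required separately: it follows from Xi x0 = 0, since a
   cone contains 0.  Xi is a total function, of which only the values on U
   matter. *)
Definition C2_cone_reducible (R : realType) (n : nat) (S : set 'rV[R]_n)
    (x0 : 'rV[R]_n) : Prop :=
  exists (m : nat) (C : set 'rV[R]_m) (U : set 'rV[R]_n)
         (Xi : 'rV[R]_n -> 'rV[R]_m),
    [/\ pointed_closed_convex_cone C,
        open_nbhs x0 U,
        C2_on U Xi,
        forall w : 'rV[R]_m, exists v : 'rV[R]_n, 'd Xi x0 v = w &
        Xi x0 = 0 /\ S `&` U = [set x | U x /\ C (Xi x)]].

(* The norm `|z| on matrices in the library is the sup norm. *)
Definition enorm (R : realType) (n : nat) (z : 'rV[R]_n) : R :=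
  Num.sqrt (\sum_(i < n) z ord0 i ^+ 2).

Definition h (R : realType) (z : 'rV[R]_2) : R :=
  let z1 := z ord0 ord0 in
  let z2 := z ord0 ord_max in
  if z == 0 then 0
  else (z1 ^+ 3 - 3 * z1 * z2 ^+ 2) / Num.sqrt (z1 ^+ 2 + z2 ^+ 2).

Definition g (R : realType) (z : 'rV[R]_2) : R := 4 * enorm z ^+ 2 + h z.

(* R^2 x R is represented by 'rV_(2 + 1), (z, t) being row_mx z t%:M. *)
Definition Sg (R : realType) : set 'rV[R]_(2 + 1) :=
  [set x | g (lsubmx x) <= rsubmx x ord0 ord0].
Arguments Sg : clear implicits.

(* Main.v *)
Require Import Defs.
From HB Require Import structures.
From mathcomp Require Import all_boot all_order all_algebra.
From mathcomp Require Import all_classical all_reals all_analysis.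
From mathcomp Require Import ring lra.
From mathcomp Require mpoly.
Import (canonicals) mpoly.
Set Implicit Arguments.
Unset Strict Implicit.
Unset Printing Implicit Defensive.
Import Order.TTheory GRing.Theory Num.Theory.
Import numFieldNormedType.Exports.
Local Open Scope classical_set_scope.
Local Open Scope ring_scope.

(** The proof rests on the polar form g = r^2 (4 + cos 3 theta), with
    cos 3 theta = Re (a + i b)^3 for the unit vector (a, b) of the direction.

    Closedness and convexity come together. Since g is positively homogeneous
    of degree 2, Euler's identity turns convexity of g into the inequality
    g w >= g'(z) w - g z for all z and w, with equality at w = z; then S is an
    intersection of closed half-spaces ([SgE]). For a fixed position of w
    relative to z, the inequality [support_ineq] is an affine function of
    (cos 3 alpha, sin 3 alpha), where alpha is the angle of z. By
    Cauchy-Schwarz it amounts to a polynomial inequality in |z|, |w| and the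
    angle between them only, and [support_gapE] writes the difference of its
    two sides as a sum of terms that are all nonnegative.

    For semialgebraicity, t >= g z reads |z| (t - 4 |z|^2) >= P z with a cubic
    P, and the square root |z| is eliminated by squaring ([root_ineq_cases]).

    Suppose now that S is the preimage of C under Xi near 0. The graph of g is
    tangent to the plane t = 0, so Xi'(0) maps each horizontal vector and its
    opposite into C; as C is pointed, Xi'(0) kills the horizontal plane. As
    Xi'(0) is onto, the target is spanned by the image w of the vertical
    vector, it is a line, and C is the half-line of w. So S is {xi >= 0} near 0
    for one twice differentiable function xi ([scalar_defining_function]), with
    derivative dt at 0, and xi vanishes on the graph of g ([boundary_zero]).
    This would make g twice differentiable at 0. But g s = 5 s^2 on the
    positive half of the first axis and g s = 3 s^2 on the negative half.
    Expanding xi to second order along these two half-parabolas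
    ([parabola_zeros]) gives l / 2 + 5 = 0 and l / 2 + 3 = 0, where l is the
    second derivative of xi along the first axis: a contradiction. *)

(** * Supporting planes of the graph of g *)

Definition cube_re (R : realType) (a b : R) : R := a ^+ 3 - 3 * a * b ^+ 2.
Definition cube_im (R : realType) (a b : R) : R := 3 * a ^+ 2 * b - b ^+ 3.

Lemma cube_unit (R : realType) (a b : R) : a ^+ 2 + b ^+ 2 = 1 ->
  cube_re a b ^+ 2 + cube_im a b ^+ 2 = 1.
Proof.
move=> ab; rewrite (_ : _ + _ = (a ^+ 2 + b ^+ 2) ^+ 3); first by rewrite ab expr1n.
by rewrite /cube_re /cube_im; ring.
Qed.

Lemma cube_re_le1 (R : realType) (a b : R) : a ^+ 2 + b ^+ 2 = 1 ->
  cube_re a b <= 1.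
Proof.
move=> /cube_unit ab; apply: le_trans (ler_norm _) _.
by rewrite -(@expr_le1 _ 2)// real_normK ?num_real// -ab lerDl sqr_ge0.
Qed.

(** With c and s the cosine and sine of the angle from z to w, r = |z| and
    p = |w|, the left side vanishes to fourth order at w = z, that is at
    d = 0, e = 0. This is why it is expanded in d and e. *)
Lemma support_gapE (R : realType) (r p c s : R) : c ^+ 2 + s ^+ 2 = 1 ->
  let e := 1 - c in let d := p - r in let y := e * p in
  16 * (p ^+ 2 + r ^+ 2 - 2 * r * p * c) ^+ 2
   - ((p ^+ 2 * cube_re c s + r ^+ 2 - 2 * r * p * c) ^+ 2
      + (p ^+ 2 * cube_im c s - 3 * r * p * s) ^+ 2)
  = 15 * d ^+ 4 + 15 * (y * r) ^+ 2
    + y * r * (60 * d ^+ 2 - 30 * y * d + 16 * y ^+ 2)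
    + 8 * e * (y * r) ^+ 2 + 8 * e * (2 - e) * y ^+ 2 * p * r.
Proof.
move=> cs /=.
have -> : cube_re c s = 4 * c ^+ 3 - 3 * c.
  by rewrite /cube_re (_ : s ^+ 2 = 1 - c ^+ 2); [ring | rewrite -cs; ring].
have -> : cube_im c s = s * (4 * c ^+ 2 - 1).
  rewrite /cube_im (_ : s ^+ 3 = s * (1 - c ^+ 2)); [ring | rewrite -cs; ring].
have -> : (p ^+ 2 * (s * (4 * c ^+ 2 - 1)) - 3 * r * p * s) ^+ 2 =
   (1 - c ^+ 2) * (p ^+ 2 * (4 * c ^+ 2 - 1) - 3 * r * p) ^+ 2.
  by rewrite -cs; ring.
ring.
Qed.

Lemma support_gap_ge0 (R : realType) (r p c s : R) :
  0 <= r -> 0 <= p -> c ^+ 2 + s ^+ 2 = 1 ->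
  (p ^+ 2 * cube_re c s + r ^+ 2 - 2 * r * p * c) ^+ 2
   + (p ^+ 2 * cube_im c s - 3 * r * p * s) ^+ 2
  <= 16 * (p ^+ 2 + r ^+ 2 - 2 * r * p * c) ^+ 2.
Proof.
move=> r0 p0 cs; rewrite -subr_ge0 (support_gapE _ _ cs).
have c1 : -1 <= c <= 1.
  rewrite -ler_norml -(@expr_le1 _ 2)// real_normK ?num_real//.
  by rewrite -cs lerDl sqr_ge0.
have [e0 e2] : 0 <= 1 - c /\ 0 <= 2 - (1 - c).
  by case/andP: c1 => *; split; lra.
set e := 1 - c in e0 e2 *; set y := e * p; set d := p - r.
have y0 : 0 <= y by exact: mulr_ge0.
have yr0 : 0 <= y * r by exact: mulr_ge0.
have d4 : 0 <= d ^+ 4 by rewrite exprn_even_ge0.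
(* The discriminant 30^2 - 4 * 60 * 16 is negative. *)
have q0 : 0 <= 60 * d ^+ 2 - 30 * y * d + 16 * y ^+ 2.
  by have := sqr_ge0 (d - y); have := sqr_ge0 d; have := sqr_ge0 y; nra.
have g1 := mulr_ge0 yr0 q0.
have g2 := mulr_ge0 e0 (sqr_ge0 (y * r)).
have g3 : 0 <= e * (2 - e) * y ^+ 2 * p * r.
  by do 4![apply: mulr_ge0 => //]; exact: sqr_ge0.
have := sqr_ge0 (y * r); lra.
Qed.

(** This is g w >= g'(z) w - g z for z = r (a, b) and w = p (x, y). As the cube
    of the complex number x + i y is that of a + i b times that of c + i s, the
    difference of the two sides is 4 Q + T A - U B, where Q = |w - z|^2, where
    the unit vector (T, U) depends on (a, b) only, and A and B depend only on
    the position of w relative to z. By Cauchy-Schwarz it suffices that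
    A^2 + B^2 <= (4 Q)^2. *)
Lemma support_ineq (R : realType) (r p a b x y : R) :
  0 <= r -> 0 <= p -> a ^+ 2 + b ^+ 2 = 1 -> x ^+ 2 + y ^+ 2 = 1 ->
  r * p * (2 * (4 + cube_re a b) * (a * x + b * y)
           - 3 * cube_im a b * (a * y - b * x)) - r ^+ 2 * (4 + cube_re a b)
  <= p ^+ 2 * (4 + cube_re x y).
Proof.
move=> r0 p0 ab xy.
set c := a * x + b * y; set s := a * y - b * x.
have cs : c ^+ 2 + s ^+ 2 = 1.
  by rewrite (_ : _ + _ = (a ^+ 2 + b ^+ 2) * (x ^+ 2 + y ^+ 2));
    [rewrite ab xy mulr1 | rewrite /c /s; ring].
have TUs := cube_unit ab.
have xE : x = a * c - b * s.
  rewrite -[LHS]mul1r -ab /c /s; ring.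
have yE : y = a * s + b * c.
  rewrite -[LHS]mul1r -ab /c /s; ring.
have Txy : cube_re x y = cube_re a b * cube_re c s - cube_im a b * cube_im c s.
  by rewrite xE yE /cube_re /cube_im; ring.
rewrite Txy.
have := support_gap_ge0 r0 p0 cs.
set A := p ^+ 2 * cube_re c s + r ^+ 2 - 2 * r * p * c.
set B := p ^+ 2 * cube_im c s - 3 * r * p * s.
set Q := p ^+ 2 + r ^+ 2 - 2 * r * p * c => AB.
have r2 : r ^+ 2 = r ^+ 2 * (c ^+ 2 + s ^+ 2) by rewrite cs mulr1.
have Q0 : 0 <= Q.
  by rewrite (_ : Q = (p - r * c) ^+ 2 + (r * s) ^+ 2);
    [rewrite addr_ge0 ?sqr_ge0 | rewrite /Q r2; ring].
move: (cube_re a b) (cube_im a b) TUs => T U TU.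
have CS : (T * A - U * B) ^+ 2 <= (4 * Q) ^+ 2.
  apply: le_trans (_ : A ^+ 2 + B ^+ 2 <= _); last first.
    by rewrite exprMn (_ : 4 ^+ 2 = 16)//; ring.
  rewrite -[leRHS]mul1r -TU -subr_ge0.
  by rewrite (_ : _ - _ = (T * B + U * A) ^+ 2); [exact: sqr_ge0|ring].
have : - (4 * Q) <= T * A - U * B.
  rewrite lerNl; apply: le_trans (ler_norm _) _; rewrite normrN.
  by rewrite -(@ler_pXn2r _ 2) ?nnegrE ?mulr_ge0// real_normK ?num_real.
rewrite -subr_ge0 => H; rewrite -subr_ge0; apply: le_trans H _.
by rewrite /A /B /Q; lra.
Qed.

Local Notation ix := (lshift 1 (ord0 : 'I_2)).
Local Notation iy := (lshift 1 (ord_max : 'I_2)).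
Local Notation it := (rshift 2 (ord0 : 'I_1)).

Lemma polar_form (R : realType) (u v : R) :
  exists r a b, [/\ 0 <= r, a ^+ 2 + b ^+ 2 = 1, u = r * a & v = r * b].
Proof.
have n0 : 0 <= u ^+ 2 + v ^+ 2 by rewrite addr_ge0 ?sqr_ge0.
have [/eqP|uv0] := eqVneq (u ^+ 2 + v ^+ 2) 0.
  rewrite paddr_eq0 ?sqr_ge0// !sqrf_eq0 => /andP[/eqP-> /eqP->].
  by exists 0, 1, 0; rewrite !mul0r expr1n expr0n addr0.
set r := Num.sqrt (u ^+ 2 + v ^+ 2).
have rN0 : r != 0 by rewrite sqrtr_eq0 -ltNge lt_neqAle eq_sym uv0.
exists r, (u / r), (v / r); split; rewrite ?sqrtr_ge0//; last 2 first.
- by rewrite mulrC divfK.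
- by rewrite mulrC divfK.
by rewrite !expr_div_n -mulrDl sqr_sqrtr// divff.
Qed.

(** The form also holds at z = 0, where r = 0 and the direction (a, b) is
    arbitrary; so the vertex is no special case below. *)
Lemma g_polar (R : realType) (z : 'rV[R]_2) (r a b : R) :
  0 <= r -> a ^+ 2 + b ^+ 2 = 1 ->
  z ord0 ord0 = r * a -> z ord0 ord_max = r * b ->
  g z = r ^+ 2 * (4 + cube_re a b).
Proof.
move=> r0 ab za zb.
have rE : Num.sqrt ((r * a) ^+ 2 + (r * b) ^+ 2) = r.
  by rewrite !exprMn -mulrDr ab mulr1 sqrtr_sqr ger0_norm.
rewrite /g /enorm !big_ord_recr big_ord0 /= add0r.
rewrite (_ : widen_ord _ _ = ord0); last exact/val_inj.
rewrite /h za zb rE mulrDr [4 * _]mulrC; congr (_ + _).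
case: ifPn => [/eqP z0|zN0].
  move: za zb; rewrite z0 !mxE => ra rb.
  rewrite (_ : r = 0) ?expr0n ?mul0r//.
  by rewrite -rE -ra -rb expr0n addr0 sqrtr0.
have rN0 : r != 0.
  apply: contra_neq zN0 => r0'; apply/rowP => i; rewrite mxE.
  case: i => -[|[|//]] ip.
  - by rewrite (_ : Ordinal ip = ord0) ?za ?r0' ?mul0r//; exact: val_inj.
  - by rewrite (_ : Ordinal ip = ord_max) ?zb ?r0' ?mul0r//; exact: val_inj.
by rewrite /cube_re; field.
Qed.

(** * Closedness and convexity *)

(** The linearization of g at r (a, b), taken at (u, v). By Euler's identity
    g'(z) z = 2 g z, its constant term is - g z. *)
Definition tangent (R : realType) (r a b u v : R) : R :=
  r * (2 * (4 + cube_re a b) * (a * u + b * v)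
       - 3 * cube_im a b * (a * v - b * u)) - r ^+ 2 * (4 + cube_re a b).

Lemma SgE (R : realType) :
  Sg R = [set x | forall r a b, 0 <= r -> a ^+ 2 + b ^+ 2 = 1 ->
    tangent r a b (x ord0 ix) (x ord0 iy) <= x ord0 it].
Proof.
apply/seteqP; split => x /=; rewrite /Sg/= !mxE.
- move=> gx r a b r0 ab; apply: le_trans gx.
  have [p [c [d [p0 cd xc yd]]]] := polar_form (x ord0 ix) (x ord0 iy).
  rewrite (g_polar p0 cd) ?mxE//; rewrite xc yd.
  apply: le_trans (support_ineq r0 p0 ab cd).
  by rewrite /tangent; lra.
- have [p [c [d [p0 cd xc yd]]]] := polar_form (x ord0 ix) (x ord0 iy).
  move=> /(_ _ _ _ p0 cd); rewrite (g_polar p0 cd) ?mxE// xc yd.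
  (* The linearization at z itself has the value g z there. *)
  apply: le_trans.
  rewrite /tangent (_ : c * (p * c) + _ = p * (c ^+ 2 + d ^+ 2)); last by ring.
  by rewrite cd; lra.
Qed.

Lemma closed_Sg (R : realType) : closed (Sg R).
Proof.
have -> : Sg R = \bigcap_(p in [set p : R * R * R |
    0 <= p.1.1 /\ p.1.2 ^+ 2 + p.2 ^+ 2 = 1])
  [set x : 'rV[R]_(2 + 1) |
    tangent p.1.1 p.1.2 p.2 (x ord0 ix) (x ord0 iy) <= x ord0 it].
  rewrite SgE; apply/seteqP.
  split=> [x H [[r a] b] /= [r0 ab]|x H r a b r0 ab]; first exact: H.
  by have /= := H (r, a, b); apply.
apply: closed_bigI => -[[r a] b] /= _.
pose f (x : 'rV[R]_(2 + 1)) : R :=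
  x ord0 it - tangent r a b (x ord0 ix) (x ord0 iy).
rewrite (_ : [set _ | _] = f @^-1` [set y | 0 <= y]); last first.
  by apply/seteqP; split=> x /=; rewrite /f subr_ge0.
apply: closed_comp; last exact: closed_ge.
move=> x _.
have cc i : {for x, continuous (fun y : 'rV[R]_(2 + 1) => y ord0 i)}.
  exact: coord_continuous.
have cM (k : R) (u : 'rV[R]_(2 + 1) -> R) :
    {for x, continuous u} -> {for x, continuous (fun y => k * u y)}.
  by move=> cu; apply: continuousM => //; exact: cst_continuous.
rewrite /f /tangent; apply: (continuousB (cc it)).
apply: continuousB; last exact: cst_continuous.
apply: (cM); apply: continuousB; apply: (cM);
  [apply: continuousD|apply: continuousB]; apply: (cM); exact: cc.
Qed.

Lemma convex_Sg (R : realType) :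
  convex_set (Sg R : set (convex_lmodType 'rV[R]_(2 + 1))).
Proof.
rewrite SgE => x y k /[!inE] /= Hx Hy r a b r0 ab.
have k0 : 0 <= k%:num by exact: ge0.
have k1 : 0 <= 1 - k%:num by rewrite subr_ge0 le1.
have := lerD (ler_wpM2l k0 (Hx _ _ _ r0 ab)) (ler_wpM2l k1 (Hy _ _ _ r0 ab)).
rewrite !mxE; apply: le_trans.
by rewrite /tangent /unstable.onem; lra.
Qed.

(** * Semialgebraicity *)

(** In the application r = |z|, T = t - 4 |z|^2 and k = h z. The right side only
    involves T, r k and r^2, which are polynomials in (z, t) while r and k are
    not. It says that T and k both vanish, or that T > 0 and |T| >= |k|, or that
    k < 0 and |T| <= |k|; each weak inequality is split into an equation and a
    strict inequality. *)
Lemma root_ineq_cases (R : realType) (r k T : R) : 0 <= r -> (r = 0 -> k = 0) ->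
  (k <= T) = [|| (T == 0) && (r * k == 0),
                 (r ^+ 2 * T ^+ 2 - (r * k) ^+ 2 == 0) && (0 < T),
                 (0 < T) && (0 < r ^+ 2 * T ^+ 2 - (r * k) ^+ 2),
                 (r ^+ 2 * T ^+ 2 - (r * k) ^+ 2 == 0) && (0 < - (r * k)) |
                 (0 < - (r * k)) && (0 < - (r ^+ 2 * T ^+ 2 - (r * k) ^+ 2))].
Proof.
rewrite le_eqVlt => /predU1P[<-|r0] kr.
  rewrite (kr erefl) expr0n /= !mul0r !expr0n subrr oppr0 !eqxx ltxx.
  by rewrite !andbT/= !andbF !orbF le_eqVlt eq_sym.
have -> : r ^+ 2 * T ^+ 2 - (r * k) ^+ 2 = r ^+ 2 * (T ^+ 2 - k ^+ 2) by ring.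
have r2 : 0 < r ^+ 2 by rewrite exprn_gt0.
have sqE (x : R) : x ^+ 2 = `|x| ^+ 2 by rewrite real_normK ?num_real.
set d := T ^+ 2 - k ^+ 2.
rewrite -!mulrN !(pmulr_rgt0 _ r0, pmulr_rgt0 _ r2) !mulf_eq0.
rewrite !(gt_eqF r0, gt_eqF r2) /= {}/d (sqE T) (sqE k).
have -> : 0 < `|T| ^+ 2 - `|k| ^+ 2 = (`|k| < `|T|).
  by rewrite subr_gt0 ltr_pXn2r ?nnegrE.
have -> : 0 < - (`|T| ^+ 2 - `|k| ^+ 2) = (`|T| < `|k|).
  by rewrite opprB subr_gt0 ltr_pXn2r ?nnegrE.
have -> : (`|T| ^+ 2 - `|k| ^+ 2 == 0) = (`|T| == `|k|).
  by rewrite subr_eq0 eqrXn2.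
case: (ltrgt0P T) => T0; case: (ltrgt0P k) => k0; apply/idP/idP; lra.
Qed.

Lemma semialgebraic_Sg (R : realType) : semialgebraic (Sg R).
Proof.
pose X : mpoly.mpoly (2 + 1) R := mpoly.mpolyX R (mpoly.mnm1 ix).
pose Y : mpoly.mpoly (2 + 1) R := mpoly.mpolyX R (mpoly.mnm1 iy).
pose Z : mpoly.mpoly (2 + 1) R := mpoly.mpolyX R (mpoly.mnm1 it).
pose q := X ^+ 2 + Y ^+ 2.
pose T := Z - q *+ 4.
pose P := X ^+ 3 - (X * Y ^+ 2) *+ 3.
pose D := q * T ^+ 2 - P ^+ 2.
exists [:: ([:: T; P], [::]); ([:: D], [:: T]); ([::], [:: T; D]);
           ([:: D], [:: - P]); ([::], [:: - P; - D])].
apply/funext => x; rewrite /Sg /= !andbT orbF; congr is_true.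
have [r [a [b [r0 ab xr yr]]]] := polar_form (x ord0 ix) (x ord0 iy).
rewrite (g_polar r0 ab) ?mxE//.
have qE : mpoly.meval (x ord0) q = r ^+ 2.
  rewrite rmorphD !rmorphXn /= !mpoly.mevalXU xr yr.
  by rewrite !exprMn -mulrDr ab mulr1.
have TE : mpoly.meval (x ord0) T = x ord0 it - 4 * r ^+ 2.
  by rewrite rmorphB rmorphMn /= mpoly.mevalXU qE mulr_natl.
have PE : mpoly.meval (x ord0) P = r * (r ^+ 2 * cube_re a b).
  rewrite rmorphB rmorphXn rmorphMn rmorphM rmorphXn /=.
  by rewrite !mpoly.mevalXU xr yr /cube_re; ring.
have DE : mpoly.meval (x ord0) D =
    r ^+ 2 * (x ord0 it - 4 * r ^+ 2) ^+ 2 - (r * (r ^+ 2 * cube_re a b)) ^+ 2.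
  by rewrite rmorphB rmorphM !rmorphXn /= qE TE PE.
rewrite !(rmorphN (mpoly.meval (x ord0))) /= TE PE DE -root_ineq_cases//.
  by rewrite mulrDr lerBrDl mulrC.
by move=> ->; rewrite expr0n mul0r.
Qed.

(** * Second-order behaviour along parabolas *)

Lemma is_derive_line (R : realType) (V : normedModType R) (f : V -> R)
    (p v : V) (t : R) :
  differentiable f (p + t *: v) ->
  is_derive t 1 (fun s => f (p + s *: v)) ('D_v f (p + t *: v)).
Proof.
move=> df; set k := fun s : R => p + s *: v.
have dk : is_diff t k ( *:%R ^~ v).
  rewrite -[ *:%R ^~ v]add0r.
  exact: (is_diffD (is_diff_cst p t) (is_diff_scalel t v)).
have dfk : differentiable (f \o k) t.
  by apply: differentiable_comp => //; exact: df.
apply: DeriveDef; first exact: diff_derivable.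
by rewrite !deriveE// diff_comp//= (@diff_val _ _ _ _ _ _ _ dk) scale1r.
Qed.

Lemma le_norm_MVT (R : realType) (f df : R -> R) (s M : R) :
  (forall x : R, `|x| <= `|s| -> is_derive x 1 f (df x)) ->
  (forall x : R, `|x| <= `|s| -> `|df x| <= M) ->
  `|f s - f 0| <= M * `|s|.
Proof.
move=> fdf dfM.
have cf (a b : R) : `|a| <= `|s| -> `|b| <= `|s| ->
    {within `[a, b], continuous f}.
  move=> as_ bs; apply: derivable_within_continuous => x.
  rewrite in_itv /= => /andP[ax xb].
  have xs : `|x| <= `|s|.
    by rewrite ler_norml; move: as_ bs; rewrite !ler_norml; lra.
  by have [] := fdf x xs.
have s0 : `|0 : R| <= `|s| by rewrite normr0.
have [s_ge0|s_lt0] := leP 0 s.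
  have [|c + ->] := MVT_segment s_ge0 (df := df) _ (cf _ _ s0 (lexx _)).
    move=> x; rewrite in_itv /= => /andP[x0 xs].
    by apply: fdf; rewrite !ger0_norm// ltW.
  rewrite in_itv /= subr0 normrM => /andP[c0 cs].
  by rewrite ler_wpM2r// dfM// !ger0_norm.
have [|c + fE] := MVT_segment (ltW s_lt0) (df := df) _ (cf _ _ (lexx _) s0).
  move=> x; rewrite in_itv /= => /andP[x0 xs].
  by apply: fdf; rewrite !ltr0_norm// lerN2 ltW.
rewrite in_itv /= distrC fE sub0r normrM normrN => /andP[c0 cs].
by rewrite ler_wpM2r// dfM// !ler0_norm ?lerN2// ltW.
Qed.

(** The mean value theorem is applied to f s - l / 2 s^2, whose derivative
    f1 s - l s is o(s) because f1 is differentiable at 0. *)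
Lemma taylor2 (R : realType) (f f1 : R -> R) (l : R) :
  (\forall s \near (0 : R), is_derive (s : R) 1 f (f1 s)) ->
  f 0 = 0 -> f1 0 = 0 ->
  is_derive (0 : R) 1 f1 l ->
  forall e, 0 < e ->
    \forall s \near (0 : R), `|f s - l / 2 * s ^+ 2| <= e * s ^+ 2.
Proof.
move=> ff1 f0 f10 [f1d f1l] e e0.
have f1_lin : \forall s \near (0 : R), `|f1 s - l * s| <= e * `|s|.
  move: f1d f1l; rewrite /derivable /derive => /cvg_ex[/= l' cl'] ll'.
  have {ll'} l'l : l' = l by rewrite -ll'; apply/esym/cvg_lim.
  move: cl'; rewrite l'l => /cvgrPdist_le /(_ _ e0).
  rewrite near_withinE; apply: filterS => s Hs.
  have [->|s0] := eqVneq s 0; first by rewrite f10 mulr0 subrr normr0 mulr0.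
  have := Hs s0; rewrite addr0 f10 subr0 scaler1 => {}Hs.
  rewrite (_ : f1 s - l * s = - (s * (l - s^-1 *: f1 s))).
    by rewrite normrN normrM mulrC ler_wpM2r.
  by rewrite /GRing.scale/= mulrBr mulrA divff// mul1r opprB mulrC.
have /nbhs_ballP[d /= d0 Hd] : \forall s \near (0 : R),
    is_derive (s : R) 1 f (f1 s) /\ `|f1 s - l * s| <= e * `|s|.
  by near do split.
apply/nbhs_ballP; exists d => // s /= sd.
have xd (x : R) : `|x| <= `|s| -> ball 0 d x.
  move: sd; rewrite -!ball_normE /= !sub0r !normrN => sd xs.
  exact: le_lt_trans sd.
have -> : e * s ^+ 2 = e * `|s| * `|s|.
  by rewrite -mulrA -normrM -expr2 ger0_norm ?sqr_ge0.
have /= := @le_norm_MVT _ (fun s => f s - l / 2 * s ^+ 2)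
  (fun s => f1 s - l * s) s (e * `|s|).
rewrite f0 expr0n/= mulr0 !subr0; apply.
- move=> x /xd /Hd [fx _].
  apply: is_derive_eq.
  by rewrite /GRing.scale /=; field.
- move=> x xs; have /Hd[_ xe] := xd _ xs.
  by apply: le_trans xe _; rewrite ler_wpM2l// ltW.
Unshelve. all: by end_near. Qed.

Lemma near_sqr_le (R : realType) (a : R) :
  \forall s \near (0 : R), `|a * s ^+ 2| <= `|s|.
Proof.
have a1 : 0 < `|a| + 1 by rewrite ltr_wpDl.
apply/nbhs_ballP; exists (`|a| + 1)^-1 => /=; first by rewrite invr_gt0.
move=> s; rewrite -ball_normE /= sub0r normrN => sa.
rewrite normrM normrX expr2 mulrA ler_piMl//.
move: sa; rewrite -(ltr_pM2l a1) divff ?gt_eqF// => sa.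
by have := normr_ge0 s; lra.
Qed.

(** On the axis t = 0, F is l / 2 s^2 + o(s^2) by Taylor; going from there to
    the parabola t = a s^2 adds c a s^2 + o(s^2), as c is the limit of the
    partial derivative of F in t. So F is (l / 2 + c a) s^2 + o(s^2) on the
    parabola. The zeros need only accumulate at 0, so that they may all lie on
    the same side. The domain |t| <= |s| contains every such parabola near 0 and
    keeps the hypotheses in terms of one variable tending to 0. *)
Lemma parabola_zeros (R : realType) (F D : R -> R -> R) (f1 : R -> R)
    (l c a : R) :
  F 0 0 = 0 -> f1 0 = 0 ->
  (\forall s \near (0 : R), is_derive (s : R) 1 (F ^~ 0) (f1 s)) ->
  is_derive (0 : R) 1 f1 l ->
  (\forall s \near (0 : R), forall t : R, `|t| <= `|s| ->
    is_derive t 1 (F s) (D s t)) ->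
  (forall e, 0 < e ->
    \forall s \near (0 : R), forall t : R, `|t| <= `|s| -> `|D s t - c| <= e) ->
  (forall d, 0 < d -> exists s, [/\ s != 0, `|s| < d & F s (a * s ^+ 2) = 0]) ->
  l / 2 + c * a = 0.
Proof.
move=> F0 f10 Ff1 f1l FD Dc Fa.
apply/eqP; apply: contraT => K0.
set K := `|l / 2 + c * a|.
have {K0} K0 : 0 < K by rewrite normr_gt0.
have a1 : 0 < `|a| + 1 by rewrite ltr_wpDl.
have e1 : 0 < K / 4 by rewrite divr_gt0.
have e2 : 0 < K / 4 / (`|a| + 1) by rewrite divr_gt0.
have /nbhs_ballP[d /= d0 Hd] : \forall s \near (0 : R),
   [/\ `|a * s ^+ 2| <= `|s|,
       `|F s 0 - l / 2 * s ^+ 2| <= K / 4 * s ^+ 2,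
       forall t : R, `|t| <= `|s| -> is_derive t 1 (F s) (D s t) &
       forall t : R, `|t| <= `|s| -> `|D s t - c| <= K / 4 / (`|a| + 1)].
  have T2 := taylor2 Ff1 F0 f10 f1l e1.
  have D2 := Dc _ e2.
  have as_ := near_sqr_le a.
  by near do split.
have [s [s0 sd Fs]] := Fa d d0.
have [] := Hd s; first by rewrite -ball_normE /= sub0r normrN.
move=> ass H1 H2 H3.
have s2 : 0 < s ^+ 2 by rewrite exprn_even_gt0.
have H4 : `|c * (a * s ^+ 2) + F s 0| <= K / 4 * s ^+ 2.
  have := @le_norm_MVT _ (fun t => F s t - c * t) (fun t => D s t - c)
    (a * s ^+ 2) (K / 4 / (`|a| + 1)).
  rewrite Fs mulr0 subr0 sub0r -opprD normrN => H; apply: le_trans (H _ _) _.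
  - move=> x xs; have Fx := H2 x (le_trans xs ass); apply: is_derive_eq.
    by rewrite /GRing.scale /= mulr1.
  - by move=> x xs; apply: H3; apply: le_trans ass.
  rewrite normrM (ger0_norm (ltW s2)) mulrA; apply: ler_wpM2r; first exact: ltW.
  by rewrite mulrAC ler_pdivrMr// ler_pM2l// lerDl.
(* Both remainders are at most K / 4 s^2, and their sum would have to be K s^2. *)
have : K * s ^+ 2 <= K / 4 * s ^+ 2 + K / 4 * s ^+ 2.
  rewrite -[in leLHS](ger0_norm (ltW s2)) -normrM.
  apply: le_trans (lerD H4 H1); apply: le_trans (ler_normB _ _).
  by rewrite le_eqVlt; apply/orP; left; apply/eqP; congr (`| _ |); ring.
have := mulr_gt0 K0 s2; lra.
Unshelve. all: by end_near. Qed.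

(** * Reduction to one scalar inequality *)

(** The curve has velocity d at 0, so f of it divided by s, which stays in the
    cone C, tends to the derivative of f at 0 along d. *)
Lemma cone_tangent (R : realType) (n m : nat) (C : set 'rV[R]_m)
    (f : 'rV[R]_n -> 'rV[R]_m) (d e : 'rV[R]_n) :
  closed C -> (forall (a : R) x, 0 <= a -> C x -> C (a *: x)) ->
  differentiable f 0 -> f 0 = 0 ->
  (\forall s \near (0 : R)^'+, C (f (s *: d + s ^+ 2 *: e))) ->
  C ('d f 0 d).
Proof.
move=> Cc Ccone df f0 Cf.
pose k (s : R) : 'rV[R]_n := s *: d + s ^+ 2 *: e.
have k0 : k 0 = 0 by rewrite /k expr0n !scale0r addr0.
have dk : is_diff (0 : R) k ( *:%R ^~ d).
  have sq : is_diff (0 : R) (fun s : R => s ^+ 2 *: e) 0.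
    have dq : is_diff (0 : R) (fun s : R => s ^+ 2) 0.
      by apply: is_diff_eq; rewrite !scale0r addr0.
    apply: DiffDef; first exact: differentiableZl.
    by rewrite diffZl// diff_val; apply/funext => s; rewrite /= scale0r.
  by apply: is_diff_eq (is_diffD (is_diff_scalel 0 d) sq) _; rewrite addr0.
have dfk : differentiable (f \o k) (0 : R).
  by apply: differentiable_comp => //; rewrite k0.
have Dfk : 'D_1 (f \o k) (0 : R) = 'd f 0 d.
  rewrite deriveE// diff_comp//= ?k0// (@diff_val _ _ _ _ _ _ _ dk) scale1r//.
have := diff_derivable (v := (1 : R)) dfk.
move: Dfk; rewrite /derivable /derive => Dl /cvg_ex[/= l cl].
have ld : l = 'd f 0 d by rewrite -Dl; apply/esym/cvg_lim.
rewrite -ld.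
apply: (@closed_cvg _ _ ((0 : R)^'+) _
  (fun h : R => h^-1 *: (f (k (h *: 1 + 0)) - f (k 0))) C) => //.
- near=> s.
  have s0 : 0 < s by [].
  rewrite k0 f0 subr0 addr0 scaler1.
  apply: Ccone; first by rewrite invr_ge0 ltW.
  by near: s.
- apply: cvg_trans cl; apply: cvg_app.
  by apply: within_subset => // s /=; rewrite lt0r => /andP[].
Unshelve. all: by end_near. Qed.

Lemma near_strip (R : realType) (V : normedModType R) (P : set V) (d e : V) :
  (\forall x \near (0 : V), P x) ->
  \forall s \near (0 : R), forall t : R, `|t| <= `|s| -> P (s *: d + t *: e).
Proof.
move=> /nbhs_ballP[r /= r0 rP].
have de : 0 < `|d| + `|e| + 1 by rewrite ltr_wpDl// addr_ge0.
apply/nbhs_ballP; exists (r / (`|d| + `|e| + 1)) => /=.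
  by rewrite divr_gt0.
move=> s; rewrite -ball_normE /= sub0r normrN ltr_pdivlMr// => sr t ts.
apply: rP; rewrite -ball_normE /= sub0r normrN.
apply: le_lt_trans (ler_normD _ _) _; rewrite !normrZ.
apply: le_lt_trans sr.
rewrite !mulrDr mulr1 -addrA lerD2l ler_wpDr// ler_wpM2r//.
Qed.

Lemma Sg_polar (R : realType) (s a b t : R) : 0 <= s -> a ^+ 2 + b ^+ 2 = 1 ->
  Sg R (s *: (a *: 'e_ix + b *: 'e_iy) + t *: 'e_it) <->
  s ^+ 2 * (4 + cube_re a b) <= t.
Proof.
move=> s0 ab; rewrite /Sg /= (g_polar s0 ab) ?mxE /=;
  by rewrite !(mulr0, addr0, add0r, mulr1).
Qed.

Lemma Sg_axis (R : realType) (t : R) : Sg R (t *: 'e_it) <-> 0 <= t.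
Proof.
have ab : 1 ^+ 2 + 0 ^+ 2 = 1 :> R by rewrite expr1n expr0n addr0.
have := Sg_polar t (lexx 0) ab.
rewrite (_ : 0 *: _ + _ = t *: 'e_it); last by rewrite scale0r add0r.
by rewrite expr0n mul0r.
Qed.

Lemma linear_rV3 (R : realType) (m : nat)
    (L : {linear 'rV[R]_(2 + 1) -> 'rV[R]_m}) v :
  L v = v ord0 ix *: L 'e_ix + v ord0 iy *: L 'e_iy + v ord0 it *: L 'e_it.
Proof.
rewrite [in LHS](row_sum_delta v) linear_sum /= !big_ord_recr big_ord0 /= add0r.
rewrite !linearZ /=.
by congr (_ *: L 'e_ _ + _ *: L 'e_ _ + _ *: L 'e_ _);
  try congr (v _ _); exact/val_inj.
Qed.

(** The partial derivatives [G k] of [xi] are, up to a constant factor, entries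
    of the Jacobian of the given map, whence their differentiability at 0. The
    proof shows that the derivative of the given map vanishes on
    horizontal vectors, so that its target is spanned by the image w of the
    vertical unit vector; [xi] is then the coefficient of w, read off on a
    nonzero coordinate i of w. *)
Lemma scalar_defining_function (R : realType) : C2_cone_reducible (Sg R) 0 ->
  exists (U : set 'rV[R]_(2 + 1)) (xi : 'rV[R]_(2 + 1) -> R)
         (G : 'I_(2 + 1) -> 'rV[R]_(2 + 1) -> R),
  [/\ (\forall x \near (0 : 'rV[R]_(2 + 1)), U x) /\ xi 0 = 0,
      forall x, U x -> (Sg R x <-> 0 <= xi x),
      forall x, U x -> differentiable xi x /\ forall k, 'D_('e_k) xi x = G k x,
      forall k, differentiable (G k) 0 &
      G ix 0 = 0 /\ G it 0 = 1].
Proof.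
move=> [m [C [U [f [[[c0 Cc0] Ccone Cc _ Cp] [Uo U0] fC2 Lonto [f0 SU]]]]]].
have nU : \forall x \near (0 : 'rV[R]_(2 + 1)), U x by apply: open_nbhs_nbhs.
have SC x : U x -> Sg R x <-> C (f x).
  move=> Ux; have := congr1 (@^~ x) SU; rewrite /setI /mkset /= => SUx.
  split => [Sx|Cx]; first by have [] : U x /\ C (f x) by rewrite -SUx.
  by have [] : Sg R x /\ U x by rewrite SUx.
have df x : U x -> differentiable f x by case/fC2.
have C0 : C 0 by rewrite -(scale0r c0); exact: Ccone.
have Ltan a b : a ^+ 2 + b ^+ 2 = 1 ->
    C ('d f 0 (a *: 'e_ix + b *: 'e_iy)).
  (* The curve stays above the graph, as g is at most 5 on the unit circle. *)
  move=> ab; apply: (cone_tangent (e := 5 *: 'e_it)) => //; first exact: df.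
  near=> s.
  have s0 : 0 < s by [].
  have Us : U (s *: (a *: 'e_ix + b *: 'e_iy) + (5 * s ^+ 2) *: 'e_it).
    suff : `|5 * s ^+ 2| <= `|s|.
      move: (5 * s ^+ 2); near: s; apply: cvg_within; exact: near_strip.
    by near: s; apply: cvg_within; exact: near_sqr_le.
  rewrite scalerA [_ * 5]mulrC; apply/SC => //; apply/(Sg_polar _ (ltW s0) ab).
  rewrite [leRHS]mulrC; apply: ler_wpM2l; first exact: sqr_ge0.
  by have := cube_re_le1 ab; lra.
have L0 a b : a ^+ 2 + b ^+ 2 = 1 -> 'd f 0 (a *: 'e_ix + b *: 'e_iy) = 0.
  move=> ab; apply: Cp; first exact: Ltan.
  by rewrite -linearN opprD -!scaleNr; apply: Ltan; rewrite !sqrrN.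
have Lx : 'd f 0 'e_ix = 0.
  have := L0 1 0; rewrite scale1r scale0r addr0; apply.
  by rewrite expr1n expr0n addr0.
have Ly : 'd f 0 'e_iy = 0.
  have := L0 0 1; rewrite scale1r scale0r add0r; apply.
  by rewrite expr1n expr0n add0r.
set w := 'd f 0 'e_it.
have LE v : 'd f 0 v = v ord0 it *: w.
  by rewrite linear_rV3 Lx Ly !scaler0 !add0r.
have Uaxis : \forall s \near (0 : R), U (s *: 'e_it).
  have := near_strip 'e_it 0 nU; apply: filterS => s /(_ 0).
  by rewrite scaler0 addr0; apply; rewrite normr0.
have Cw : C w.
  apply: (cone_tangent (e := 0)) => //; first exact: df.
  near=> s.
  have s0 : 0 < s by [].
  rewrite scaler0 addr0; apply/SC; last exact/Sg_axis/ltW.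
  by near: s; exact: cvg_within.
have span u : exists k, u = k *: w.
  by have [v <-] := Lonto u; exists (v ord0 it); rewrite LE.
have w0 : w != 0.
  apply/eqP => w0.
  (* The target would be 0, and S would contain points (0, s) with s < 0. *)
  have [s [s0 Us]] : exists s : R, s < 0 /\ U (s *: 'e_it).
    have : \forall s \near (0 : R)^'-, s < 0 /\ U (s *: 'e_it).
      near=> s; split => //.
      by near: s; exact: cvg_within.
    by move=> /filter_ex.
  have [k fk] := span (f (s *: 'e_it)).
  have : Sg R (s *: 'e_it) by apply/SC => //; rewrite fk w0 scaler0.
  by move=> /Sg_axis; rewrite leNgt s0.
have [i wi] : exists i, w ord0 i != 0 by apply/rV0Pn.
have Ck (k : R) : C (k *: w) <-> 0 <= k.
  split=> [Ckw|k0]; last exact: Ccone.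
  rewrite leNgt; apply/negP => k0; move/eqP: w0; apply; apply: Cp => //.
  have := Ccone (- k^-1) _ _ Ckw.
  rewrite scalerA mulNr mulVf ?lt_eqF// scaleN1r.
  by apply; rewrite oppr_ge0 invr_le0 ltW.
exists U, (fun x => f x ord0 i / w ord0 i),
  (fun k x => jacobian f x k i / w ord0 i).
split.
- by split => //; rewrite f0 mxE mul0r.
- move=> x Ux; have [k fk] := span (f x).
  apply: iff_trans (SC x Ux) _.
  by rewrite fk mxE mulfK//; exact: Ck.
- move=> x Ux.
  have dfi : differentiable (fun x => f x ord0 i) x.
    exact: (differentiable_comp (df x Ux) (differentiable_coord _ _ _)).
  split; first by apply: differentiableM => //; exact: differentiable_cst.
  move=> k.
  have dfik : derivable (fun x => f x ord0 i) x 'e_k by exact: diff_derivable.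
  rewrite (_ : (fun x => _) = (w ord0 i)^-1 *: (fun x => f x ord0 i)); last first.
    by apply/funext => y; rewrite /= mulrC.
  rewrite deriveZ// /GRing.scale /= mulrC; congr (_ / _).
  have := derive_mx (diff_derivable (v := 'e_k) (df x Ux)).
  rewrite deriveEjacobian; last exact: df.
  move=> /(congr1 (fun M : 'rV[R]_m => M ord0 i)).
  by rewrite -rowE mxE => ->; rewrite mxE.
- move=> k; have [_ dJ _] := fC2 0 U0.
  apply: differentiableM; last exact: differentiable_cst.
  exact: (differentiable_comp dJ (differentiable_coord _ _ _)).
- have JE k : jacobian f 0 k i = 'd f 0 'e_k ord0 i.
    by rewrite /jacobian mxE.
  by rewrite !JE Lx mxE mul0r divff.
Unshelve. all: by end_near. Qed.

(** * Failure of reducibility *)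

(** On the graph xi >= 0, as it lies in S; just below it xi < 0, so that also
    xi <= 0 on the graph by continuity. *)
Lemma boundary_zero (R : realType) (U : set 'rV[R]_(2 + 1))
    (xi : 'rV[R]_(2 + 1) -> R) (a b : R) :
  (\forall x \near (0 : 'rV[R]_(2 + 1)), U x) ->
  (forall x, U x -> Sg R x <-> 0 <= xi x) ->
  (forall x, U x -> differentiable xi x) ->
  a ^+ 2 + b ^+ 2 = 1 ->
  \forall s \near (0 : R)^'+,
    xi (s *: (a *: 'e_ix + b *: 'e_iy)
        + ((4 + cube_re a b) * s ^+ 2) *: 'e_it) = 0.
Proof.
move=> nU Sxi dxi ab.
set u := a *: _ + b *: _; set k := 4 + cube_re a b.
near=> s.
have s0 : 0 < s by [].
have Unear : \forall x \near s *: u + (k * s ^+ 2) *: 'e_it, U x.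
  suff : `|k * s ^+ 2| <= `|s|.
    move: (k * s ^+ 2); near: s; apply: cvg_within.
    exact: (@near_strip _ _ (interior U) _ _ (nbhs_interior nU)).
  by near: s; apply: cvg_within; exact: near_sqr_le.
have Uq := nbhs_singleton Unear.
apply/eqP; rewrite eq_le; apply/andP; split; last first.
  by apply/Sxi => //; apply/(Sg_polar _ (ltW s0) ab); rewrite mulrC.
rewrite leNgt; apply/negP => xi_gt0.
pose line (t : R) := s *: u + t *: 'e_it.
have cline : {for k * s ^+ 2, continuous line}.
  apply: continuousD; first exact: cst_continuous.
  exact: scalel_continuous.
have cxi : {for k * s ^+ 2, continuous (xi \o line)}.
  by apply: continuous_comp => //; apply: differentiable_continuous; exact: dxi.
have [t [tk Ut xit]] : exists t,
    [/\ t < k * s ^+ 2, U (line t) & 0 < xi (line t)].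
  have : \forall t \near (k * s ^+ 2)^'-,
      [/\ t < k * s ^+ 2, U (line t) & 0 < xi (line t)].
    near=> t; split => //; near: t; apply: cvg_within.
    - exact: cline Unear.
    - exact: (cvgr_gt _ cxi).
  by move=> /filter_ex.
have /Sxi := ltW xit => /(_ Ut) /(Sg_polar _ (ltW s0) ab).
by rewrite mulrC leNgt tk.
Unshelve. all: by end_near. Qed.

Lemma not_C2_cone_reducible_Sg (R : realType) : ~ C2_cone_reducible (Sg R) 0.
Proof.
move=> /scalar_defining_function [U [xi [G [[nU xi0] Sxi dxi dG [Gx Gt]]]]].
have zero a b :=
  boundary_zero nU Sxi (fun x Ux => (dxi x Ux).1) (a := a) (b := b).
(* For a = 1 and a = -1 the graph lies over the two halves of the first axis;
   k = g (a, 0) is the coefficient of the parabola that it follows there. *)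
have key (a k : R) : a ^+ 2 = 1 -> k = 4 + cube_re a 0 ->
    'D_1 (fun s : R => G ix (s *: 'e_ix)) 0 / 2 + 1 * k = 0.
  move=> a1 ->.
  have ab : a ^+ 2 + 0 ^+ 2 = 1 by rewrite a1 expr0n addr0.
  apply: (@parabola_zeros _ (fun s t => xi (s *: 'e_ix + t *: 'e_it))
    (fun s t => G it (s *: 'e_ix + t *: 'e_it)) (fun s => G ix (s *: 'e_ix))).
  - by rewrite !scale0r addr0.
  - by rewrite scale0r.
  - have := near_strip 'e_ix 0 nU; apply: filterS => s /(_ 0).
    rewrite normr0 scaler0 addr0 => /(_ (normr_ge0 s)) Us.
    have [dx DG] := dxi _ Us.
    rewrite -DG -[X in 'D_('e_ix) xi X]add0r.
    rewrite (_ : (fun r : R => _) = fun r => xi (0 + r *: 'e_ix)); last first.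
      by apply/funext => r; rewrite scale0r addr0 add0r.
    by apply: is_derive_line; rewrite add0r.
  - apply: derivableP.
    rewrite (_ : (fun s : R => _) = fun s => G ix (0 + s *: 'e_ix)); last first.
      by apply/funext => r; rewrite add0r.
    have dGx : differentiable (G ix) (0 + (0 : R) *: 'e_ix).
      by rewrite scale0r addr0.
    by have [] := is_derive_line dGx.
  - have := near_strip 'e_ix 'e_it nU; apply: filterS => s Us t /Us Ust.
    have [dx DG] := dxi _ Ust.
    by rewrite -DG; exact: is_derive_line.
  - move=> e e0.
    apply: (@near_strip _ _ [set x | `|G it x - 1| <= e]).
    have := differentiable_continuous (dG it).
    move=> /cvgrPdist_le /(_ _ e0); rewrite Gt.
    by apply: filterS => x /=; rewrite distrC.
  - move=> d d0.
    have : \forall s \near (0 : R)^'+, [/\ s != 0, `|s| < d &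
       xi (s *: (a *: 'e_ix + 0 *: 'e_iy)
           + ((4 + cube_re a 0) * s ^+ 2) *: 'e_it) = 0].
      near=> s.
      have s0 : 0 < s by [].
      split; first by rewrite gt_eqF.
      - by rewrite gtr0_norm//; near: s; exact: nbhs_right_lt.
      - by near: s; exact: zero.
    move=> /filter_ex [s [s0 sd Hs]]; exists (s * a).
    have an : `|a| = 1.
      by apply/eqP; rewrite -(@eqrXn2 _ 2)// real_normK ?num_real// a1 expr1n.
    split.
    + by rewrite mulf_neq0// -normr_eq0 an oner_neq0.
    + by rewrite normrM an mulr1.
    + by move: Hs; rewrite scale0r addr0 scalerA exprMn a1 mulr1.
have := key 1 5; have := key (-1) 3.
rewrite expr1n sqrrN expr1n /cube_re => /(_ erefl) k3 /(_ erefl) k1.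
have {}k3 := k3 ltac:(ring); have {}k1 := k1 ltac:(ring).
lra.
Unshelve. all: by end_near. Qed.

Theorem lemma5p1 (R : realType) :
  [/\ closed (Sg R),
      convex_set (Sg R : set (convex_lmodType 'rV[R]_(2 + 1))),
      semialgebraic (Sg R) &
      ~ C2_cone_reducible (Sg R) 0].
Proof.
split.
- exact: closed_Sg.
- exact: convex_Sg.
- exact: semialgebraic_Sg.
- exact: not_C2_cone_reducible_Sg.
Qed.
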